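(* Let $q\ge2$, $d\ge1$, let $(\rho_r)_{r\in\mathcal V_{q,d}}$ be complex numbers, and let $P^\circ=(P^\circ_{xy})_{x,y\in\mathcal V_{q,d}}$ be the matrix with entries $$P^\circ_{xy}=\frac1{q^d}\sum_{r\in\mathcal V_{q,d}}\rho_r\prod_{k=1}^d\theta_{r[k]}^{x[k]}\theta_{r[k]}^{-y[k]}=\frac1{q^d}\sum_{r\in\mathcal V_{q,d}}\rho_r\,\theta_1^{(x-y)\cdot r}.$$ Then $P^\circ$ is non-negative and a transition probability matrix if and only if there is a random variable $V=(V[1],\ldots,V[d])$ on $\mathcal V_{q,d}$ such that $$\rho_r=\mathbb E\Big[\prod_{k=1}^d\theta_{r[k]}^{V[k]}\Big]=\mathbb E\big[\theta_1^{V\cdot r}\big],\qquad r\in\mathcal V_{q,d}.$$ If $r$ has all entries zero then $\rho_r=1$ in this case.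
   Context: $\mathcal V_q=\{0,1,\ldots,q-1\}$ and $\mathcal V_{q,d}=\mathcal V_q^d$; entries of a vector $x\in\mathcal V_{q,d}$ are written $x[1],\ldots,x[d]$. For an integer $l$, $\theta_l=e^{2\pi i l/q}$, and $x\cdot r=\sum_{k=1}^d x[k]r[k]$. The entries of $V$ need not be independent or identically distributed. A transition probability matrix is a matrix with real non-negative entries all of whose rows sum to $1$. *)

(* Defs.v *)
From mathcomp Require Import all_boot all_order all_algebra.
From mathcomp Require Import all_classical all_reals all_analysis.
From mathcomp Require Export complex.

Set Implicit Arguments.
Unset Strict Implicit.
Unset Printing Implicit Defensive.

Import Order.TTheory GRing.Theory Num.Theory.

Local Open Scope classical_set_scope.
Local Open Scope ring_scope.
Local Open Scope complex_scope.

Definition Vec (q d : nat) := {ffun 'I_d -> 'I_q}.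

(* The entries as integers: differences and dot products are taken over the
   integers, not modulo q. *)
Definition zvec (q d : nat) (x : Vec q d) : {ffun 'I_d -> int} :=
  [ffun k => (x k : nat)%:Z].

Definition dot (d : nat) (u v : {ffun 'I_d -> int}) : int :=
  \sum_(k < d) u k * v k.

(* exp (i t), by Euler's formula *)
Definition expi (R : realType) (t : R) : R[i] := cos t +i* sin t.

Definition theta (R : realType) (q : nat) (l : int) : R[i] :=
  expi (2 * pi * l%:~R / q%:R).

Definition Pcirc (R : realType) (q d : nat) (rho : Vec q d -> R[i])
    (x y : Vec q d) : R[i] :=
  (q ^ d)%:R^-1 *
  \sum_(r : Vec q d)
     rho r * \prod_(k < d) (theta R q (r k : nat) ^+ x k *
                            theta R q (r k : nat) ^- y k).

(* In the partial order of R[i], 0 <= z means that z is real and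
   nonnegative. *)
Definition nonnegative_matrix (R : realType) (I : finType)
    (M : I -> I -> R[i]) : Prop :=
  forall x y, 0 <= M x y.

Definition transition_matrix (R : realType) (I : finType)
    (M : I -> I -> R[i]) : Prop :=
  nonnegative_matrix M /\ forall x, \sum_(y : I) M x y = 1.

(* Measurability with respect to the discrete sigma-algebra of S.  The
   library's measurable types are pointed, which 'I_q is not for a variable q,
   so {RV P >-> S} is not available here. *)
Definition discrete_rv (disp : measure_display) (T : measurableType disp)
    (S : finType) (V : T -> S) : Prop :=
  forall A : set S, measurable (V @^-1` A).

(* [fine] loses nothing on bounded random variables. *)
Definition cexpectation (R : realType) (disp : measure_display)
    (T : measurableType disp) (P : probability T R) (X : T -> R[i]) : R[i] :=
  fine ('E_P[fun w => complex.Re (X w)])%E +i*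
  fine ('E_P[fun w => complex.Im (X w)])%E.

(* Main.v *)
(* Each character x |-> theta_1^(x.r) is an eigenvector of P with eigenvalue
   rho_r, because the characters are orthogonal.  Reading the eigenvector
   equation in row x = 0 gives rho_r = \sum_v P_(0,v) theta_1^(v.r), so V can
   be given the law P_(0,.); reading it at r = 0 gives that every row of P sums
   to rho_0.  Conversely, inserting rho_r = E[theta_1^(V.r)] into P_(x,y) and
   summing over r leaves P(V = y - x mod q). *)

From HB Require Import structures.
Require Import Defs.
From mathcomp Require Import all_boot all_order all_algebra.
From mathcomp Require Import all_classical all_reals all_analysis.
From mathcomp Require Import complex.
From mathcomp Require Import ring.

Set Implicit Arguments.
Unset Strict Implicit.
Unset Printing Implicit Defensive.

Import Order.TTheory GRing.Theory Num.Theory.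
Local Open Scope ring_scope.

Lemma expi0 (R : realType) : expi 0 = 1 :> R[i].
Proof. by rewrite /expi cos0 sin0. Qed.

Lemma expiD (R : realType) (s t : R) : expi (s + t) = expi s * expi t.
Proof.
by apply/eqP; rewrite eq_complex /= cosD sinD eqxx /= [X in _ == X]addrC.
Qed.

Lemma expi_natmul (R : realType) (t : R) (n : nat) :
  expi (t * n%:R) = expi t ^+ n.
Proof.
elim: n => [|n IHn]; first by rewrite mulr0 expi0 expr0.
by rewrite -natr1 mulrDr mulr1 expiD IHn exprSr.
Qed.

Section Characters.
Variables (R : realType) (q : nat).
Hypothesis q_gt0 : (0 < q)%N.

Let q_neq0 : q%:R != 0 :> R. Proof. by rewrite pnatr_eq0 -lt0n. Qed.

Lemma theta_exp (n : nat) : theta R q n = theta R q 1 ^+ n.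
Proof.
rewrite /theta -expi_natmul; congr expi.
by rewrite !pmulrn mulr1 mulrAC.
Qed.

Lemma theta_expq (n : nat) : theta R q n ^+ q = 1.
Proof.
rewrite theta_exp exprAC -theta_exp /theta -pmulrn mulfK //.
by rewrite mulrC -[2]/(2%:R) mulr_natr /expi cos2pi sin2pi expr1n.
Qed.

Lemma theta_neq0 (n : nat) : theta R q n != 0.
Proof.
apply: contra_eq_neq (theta_expq n) => ->.
by rewrite expr0n gtn_eqF // eq_sym oner_eq0.
Qed.

Lemma theta_neq1 (n : nat) : (0 < n < q)%N -> theta R q n != 1.
Proof.
move=> /andP[n_gt0 n_ltq]; pose t : R := pi * n%:R / q%:R.
have t_gt0 : 0 < t by rewrite divr_gt0 ?mulr_gt0 ?pi_gt0 ?ltr0n.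
have t_ltpi : t < pi.
  by rewrite ltr_pdivrMr ?ltr0n // ltr_pM2l ?pi_gt0 // ltr_nat.
have sint : 0 < sin t by apply: sin_gt0_pi; rewrite t_gt0.
have -> : theta R q n = expi (t *+ 2).
  rewrite /theta -pmulrn; congr expi; rewrite -[RHS]mulr_natl /t.
  by rewrite !mulrA.
apply/negP; rewrite eq_complex /= cos_mulr2n cos2sin2 => /andP[+ _].
rewrite subr_eq eqr_pMn2r // -subr_eq0 addrAC subrr add0r oppr_eq0.
by rewrite expf_eq0 gt_eqF.
Qed.

Lemma theta_inj (i j : 'I_q) : theta R q (i : nat) = theta R q (j : nat) -> i = j.
Proof.
wlog lij : i j / (i <= j)%N.
  by move=> H; have [/H|/ltnW/H h /esym/h] := leqP i j.
move=> e; apply/val_inj/eqP; rewrite eqn_leq lij leqNgt /=.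
apply/negP => ltij.
have : theta R q (j - i)%N == 1.
  rewrite -(inj_eq (mulfI (theta_neq0 i))) mulr1 [X in _ == X]e.
  by rewrite (theta_exp i) (theta_exp (j - i)) -exprD subnKC // -theta_exp.
by apply/negP/theta_neq1; rewrite subn_gt0 ltij (leq_ltn_trans (leq_subr _ _)).
Qed.

End Characters.

Lemma geometric_sum_unity (F : fieldType) (q : nat) (z : F) :
  z ^+ q = 1 -> \sum_(j < q) z ^+ j = if z == 1 then q%:R else 0.
Proof.
move=> zq; case: eqP => [->|/eqP z1].
  by under eq_bigr do rewrite expr1n; rewrite sumr_const card_ord.
apply/eqP; have := subrX1 z q; rewrite zq subrr => /esym/eqP.
by rewrite mulf_eq0 subr_eq0 (negbTE z1).
Qed.

Lemma sum_prod_unity (F : fieldType) (q d : nat) (z : 'I_d -> F) :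
  (forall k, z k ^+ q = 1) ->
  \sum_(r : Vec q d) \prod_(k < d) z k ^+ r k =
  if [forall k, z k == 1] then (q ^ d)%:R else 0.
Proof.
move=> zq; rewrite -(bigA_distr_bigA (fun k (j : 'I_q) => z k ^+ j)) /=.
rewrite (eq_bigr (fun k => if z k == 1 then q%:R else 0)); last first.
  by move=> k _; rewrite geometric_sum_unity.
case: forallP => [z1|/forallP].
  rewrite (eq_bigr (fun=> q%:R)); last by move=> k _; rewrite z1.
  by rewrite prodr_const card_ord natrX.
by rewrite negb_forall => /existsP[k /negbTE zk]; rewrite (bigD1 k) //= zk mul0r.
Qed.

Section Spectral.
Variables (R : realType) (q d : nat).
Hypothesis q_gt0 : (0 < q)%N.
Implicit Types (rho : Vec q d -> R[i]) (x y r : Vec q d).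

Lemma qd_neq0 : (q ^ d)%:R != 0 :> R[i].
Proof. by rewrite pnatr_eq0 -lt0n expn_gt0 q_gt0. Qed.

Lemma Pcirc_eigenvector rho x r :
  \sum_y Pcirc rho x y * \prod_(k < d) theta R q (r k : nat) ^+ y k =
  rho r * \prod_(k < d) theta R q (r k : nat) ^+ x k.
Proof.
pose z (s : Vec q d) k := theta R q (r k : nat) / theta R q (s k : nat).
transitivity ((q ^ d)%:R^-1 * \sum_(s : Vec q d)
   rho s * (\prod_(k < d) theta R q (s k : nat) ^+ x k) *
   \sum_(y : Vec q d) \prod_(k < d) z s k ^+ y k).
  under eq_bigr do rewrite /Pcirc -mulrA mulr_suml.
  rewrite -mulr_sumr exchange_big /=; congr (_ * _); apply: eq_bigr => s _.
  rewrite mulr_sumr; apply: eq_bigr => y _.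
  rewrite -!mulrA -!big_split /=; congr (_ * _); apply: eq_bigr => k _.
  by rewrite /z exprMn exprVn -mulrA [X in _ * X]mulrC.
rewrite (bigD1 r) //= [X in _ + X]big1 => [|s sr]; last first.
  rewrite sum_prod_unity => [|k]; last first.
    by rewrite exprMn exprVn !theta_expq // mul1r invr1.
  case: forallP => [z1|_]; last by rewrite mulr0.
  case/eqP: sr; apply/ffunP => k; apply: (theta_inj (R := R) q_gt0).
  by apply/esym/divr1_eq/eqP/z1.
rewrite addr0 sum_prod_unity => [|k]; last first.
  by rewrite exprMn exprVn !theta_expq // mul1r invr1.
rewrite ifT; first by rewrite mulrC mulfK ?qd_neq0.
by apply/forallP => k; rewrite /z divff ?theta_neq0.
Qed.

Lemma Pcirc_row_sum rho x r : (forall k, r k = 0%N :> nat) ->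
  \sum_y Pcirc rho x y = rho r.
Proof.
move=> r0; have := Pcirc_eigenvector rho x r.
have one y : \prod_(k < d) theta R q (r k : nat) ^+ y k = 1.
  by apply: big1 => k _; rewrite r0 theta_exp expr0 expr1n.
by rewrite one mulr1 => <-; apply: eq_bigr => y _; rewrite one mulr1.
Qed.

Lemma Pcirc_fourier_ge0 (p : Vec q d -> R[i]) rho x y : (forall v, 0 <= p v) ->
  (forall r, rho r =
     \sum_v p v * \prod_(k < d) theta R q (r k : nat) ^+ v k) ->
  0 <= Pcirc rho x y.
Proof.
move=> p_ge0 rhoE.
pose z (v : Vec q d) k := theta R q (v k : nat) *
  (theta R q (x k : nat) / theta R q (y k : nat)).
have -> : Pcirc rho x y = (q ^ d)%:R^-1 *
    \sum_v p v * \sum_(r : Vec q d) \prod_(k < d) z v k ^+ r k.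
  congr (_ * _); under eq_bigr do rewrite rhoE mulr_suml.
  rewrite exchange_big /=; apply: eq_bigr => v _.
  rewrite mulr_sumr; apply: eq_bigr => r _.
  rewrite -mulrA -big_split /=; congr (_ * _); apply: eq_bigr => k _.
  rewrite /z !exprMn exprVn.
  rewrite (theta_exp _ _ (r k)) (theta_exp _ _ (v k)) (theta_exp _ _ (x k)).
  rewrite (theta_exp _ _ (y k)) -!exprM.
  by rewrite (mulnC (v k)) (mulnC (x k)) (mulnC (y k)).
rewrite mulr_ge0 ?invr_ge0 ?ler0n //; apply: sumr_ge0 => v _.
rewrite mulr_ge0 // sum_prod_unity => [|k]; last first.
  by rewrite !exprMn exprVn !theta_expq // !mul1r invr1.
by case: ifP => // _; rewrite ler0n.
Qed.

Lemma prod_theta_dot x r :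
  \prod_(k < d) theta R q (r k : nat) ^+ x k =
  theta R q 1 ^ dot (zvec x) (zvec r).
Proof.
have t1 : theta R q 1 \is a GRing.unit by rewrite unitfE (theta_neq0 R q_gt0 1).
rewrite /dot (big_morph _ (fun m n => exprzDr t1 m n) (expr0z _)).
apply: eq_bigr => k _; rewrite !ffunE theta_exp -exprM.
by rewrite mulnC.
Qed.

Lemma prod_theta_dotB x y r :
  \prod_(k < d) (theta R q (r k : nat) ^+ x k * theta R q (r k : nat) ^- y k) =
  theta R q 1 ^ dot (zvec x - zvec y) (zvec r).
Proof.
have t1 : theta R q 1 \is a GRing.unit by rewrite unitfE (theta_neq0 R q_gt0 1).
have -> : dot (zvec x - zvec y) (zvec r) =
    dot (zvec x) (zvec r) - dot (zvec y) (zvec r).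
  by rewrite /dot -sumrB; apply: eq_bigr => k _; rewrite !ffunE mulrBl.
by rewrite exprzDr // -invr_expz -!prod_theta_dot big_split /= prodfV.
Qed.

End Spectral.

Section FiniteExpectation.
Variables (R : realType) (disp : measure_display) (T : measurableType disp).
Variables (P : probability T R) (S : finType) (V : T -> S).
Hypothesis mV : discrete_rv V.

Let mass (s : S) : R := fine (P (V @^-1` [set s])%classic).

Lemma expectation_discrete (g : S -> R) :
  ('E_P[fun w => g (V w)] = (\sum_s mass s * g s)%:E)%E.
Proof.
have mA s : measurable (V @^-1` [set s])%classic by exact: mV.
rewrite unlock.
transitivity (\int[P]_w (\sum_s (g s)%:E * (\1_(V @^-1` [set s])%classic w)%:E))%E.
  apply: eq_integral => w _; rewrite (bigD1 (V w)) //= big1 => [|s sV].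
    by rewrite adde0 indicE mem_set // mule1.
  by rewrite indicE memNset ?mule0 //= => Vs; rewrite Vs eqxx in sV.
rewrite integral_sum //= => [|s]; last first.
  by apply: integrableZl => //; apply: integrable_indic; rewrite ?fin_num_fun_lty.
rewrite -sumEFin; apply: eq_bigr => s _.
rewrite integralZl //; last exact: integrable_indic.
by rewrite integral_indic // setIT EFinM fineK ?fin_num_measure // muleC.
Qed.

Lemma cexpectation_discrete (f : S -> R[i]) :
  cexpectation P (fun w => f (V w)) = \sum_s (mass s)%:C%C * f s.
Proof.
rewrite /cexpectation (expectation_discrete (fun s => complex.Re (f s))).
rewrite (expectation_discrete (fun s => complex.Im (f s))) /=.
apply/eqP; rewrite eq_complex /= !raddf_sum /=.
apply/andP; split; apply/eqP/eq_bigr => s _; case: (f s) => a b /=; ring.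
Qed.

End FiniteExpectation.

(* The sample space is nat rather than S because measurable types are pointed;
   V enumerates S, and the measure lives on its first #|S| points. *)
Lemma exists_discrete_rv (R : realType) (S : finType) (s0 : S) (p : S -> R) :
  (forall s, 0 <= p s) -> \sum_s p s = 1 ->
  exists (disp : measure_display) (T : measurableType disp)
         (P : probability T R) (V : T -> S),
    discrete_rv V /\ forall s, fine (P (V @^-1` [set s])%classic) = p s.
Proof.
move=> p_ge0 p_sum; pose V (n : nat) := nth s0 (enum S) n.
pose w (n : nat) : {measure set nat -> \bar R} :=
  mscale (NngNum (p_ge0 (V n))) \d_n.
pose mu := msum w #|S|.
have muE (A : set S) :
    mu (V @^-1` A)%classic = (\sum_s p s * (s \in A)%:R)%:E.
  rewrite /mu /= /msum (reindex _ (onW_bij _ (enum_val_bij S))) /= -sumEFin.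
  apply: eq_bigr => i _; rewrite (enum_val_nth s0) -/(V i) /mscale /= diracE.
  by rewrite EFinM; congr (_ * (_%:R)%:E)%E.
have muT : mu setT = 1%E.
  rewrite -(preimage_setT V) muE; congr EFin; rewrite -[RHS]p_sum.
  by apply: eq_bigr => s _; rewrite mem_set // mulr1.
pose P : probability nat R :=
  HB.pack (msum w #|S|) (Measure_isProbability.Build _ _ _ mu muT).
exists _, _, P, V; split=> [//|s].
rewrite /P /= -/mu muE /= (bigD1 s) //= big1 => [|t ts].
  by rewrite addr0 mem_set // mulr1.
by rewrite memNset ?mulr0 //= => /eqP; rewrite (negbTE ts).
Qed.

Theorem proposition6 (R : realType) (q d : nat) (hq : (2 <= q)%N)
    (hd : (1 <= d)%N) (rho : Vec q d -> R[i]) :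
  [/\ (forall x y : Vec q d,
         Pcirc rho x y =
         (q ^ d)%:R^-1 *
         \sum_(r : Vec q d)
            rho r * theta R q 1 ^ dot (zvec x - zvec y) (zvec r)),
      (forall (disp : measure_display) (T : measurableType disp)
              (P : probability T R) (V : T -> Vec q d),
         discrete_rv V ->
         forall r : Vec q d,
           cexpectation P
             (fun w => \prod_(k < d) theta R q (r k : nat) ^+ V w k) =
           cexpectation P
             (fun w => theta R q 1 ^ dot (zvec (V w)) (zvec r))),
      (nonnegative_matrix (Pcirc rho) /\ transition_matrix (Pcirc rho)
       <->
       exists (disp : measure_display) (T : measurableType disp)
              (P : probability T R) (V : T -> Vec q d),
         discrete_rv V /\
         forall r : Vec q d,
           rho r = cexpectation P
             (fun w => \prod_(k < d) theta R q (r k : nat) ^+ V w k)) &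
      (nonnegative_matrix (Pcirc rho) /\ transition_matrix (Pcirc rho) ->
       forall r : Vec q d, (forall k : 'I_d, r k = 0%N :> nat) -> rho r = 1)].
Proof.
have q_gt0 : (0 < q)%N by exact: leq_trans hq.
pose z0 : Vec q d := [ffun=> Ordinal q_gt0].
have z00 k : z0 k = 0%N :> nat by rewrite ffunE.
have rho1 : nonnegative_matrix (Pcirc rho) /\ transition_matrix (Pcirc rho) ->
    forall r : Vec q d, (forall k : 'I_d, r k = 0%N :> nat) -> rho r = 1.
  by move=> [_ [_ P1]] r r0; rewrite -(P1 z0) (Pcirc_row_sum q_gt0 _ _ r0).
split=> [x y|disp T P V _ r||//].
- congr (_ * _); apply: eq_bigr => r _.
  by rewrite (prod_theta_dotB _ q_gt0).
- by congr cexpectation; apply/funext => w; rewrite (prod_theta_dot _ q_gt0).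
split=> [[P_ge0 [_ P1]]|[disp [T [P [V [mV rhoE]]]]]].
  pose p (v : Vec q d) : R := complex.Re (Pcirc rho z0 v).
  have pE v : (p v)%:C%C = Pcirc rho z0 v.
    by apply: RRe_real; apply: ger0_real.
  have p_ge0 v : 0 <= p v by rewrite -lecR pE.
  have p_sum : \sum_v p v = 1.
    apply: (@complexI R); rewrite rmorph_sum rmorph1 -(P1 z0).
    by apply: eq_bigr => v _; exact: pE.
  have [disp [T [P [V [mV PV]]]]] := exists_discrete_rv z0 p_ge0 p_sum.
  exists disp, T, P, V; split=> // r.
  rewrite (cexpectation_discrete P mV
    (fun v => \prod_(k < d) theta R q (r k : nat) ^+ v k)).
  have := Pcirc_eigenvector q_gt0 rho z0 r.
  rewrite [X in _ = _ * X]big1 => [|k _]; last by rewrite z00 expr0.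
  by rewrite mulr1 => <-; apply: eq_bigr => v _; rewrite PV pE.
have P_ge0 : nonnegative_matrix (Pcirc rho).
  move=> x y; apply: (Pcirc_fourier_ge0 (rho := rho) q_gt0
    (p := fun v => (fine (P (V @^-1` [set v])%classic))%:C%C)) => [v|r].
    by rewrite lecR fine_ge0 // measure_ge0.
  rewrite rhoE; exact: (cexpectation_discrete P mV
    (fun v => \prod_(k < d) theta R q (r k : nat) ^+ v k)).
split=> //; split=> // x; rewrite (Pcirc_row_sum q_gt0 _ _ z00) rhoE.
have -> : (fun w => \prod_(k < d) theta R q (z0 k : nat) ^+ V w k) = cst 1.
  apply/funext => w; apply: big1 => k _.
  by rewrite z00 theta_exp expr0 expr1n.
by rewrite /cexpectation /= !expectation_cst.
Qed.
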